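(* Let $n\ge1$, $m\ge1$, let $(C,\phi)$ be the multistate monotone system with $C=\{1,\ldots,n\}$, $\mathcal{S}_i=\{0,1,\ldots,m\}$ for all $i$, system state set $\{0,1,\ldots,nm\}$, and $\phi(\bm{x})=\sum_{i=1}^n x_i$. Then for $k\in\{1,\ldots,nm\}$ the signed domination of the $k$-level structure function $\phi_k(\bm{x})=\mathrm{I}(\sum_{i=1}^n x_i\ge k)$ is $$d(\phi_k)=\begin{cases}(-1)^{n-(k-n(m-1))}\binom{n-1}{(k-n(m-1))-1}, & n(m-1)<k\le nm,\\ 0, & \text{otherwise.}\end{cases}$$
   Context: Vectors are ordered componentwise. For the non-decreasing binary function $\phi_k$ on $\mathfrak{C}=\{0,\ldots,m\}^n$, a minimal $k$-level path vector is $\bm{x}\in\mathfrak{C}$ with $\phi_k(\bm{x})=1$ and $\phi_k(\bm{y})=0$ for all $\bm{y}\le\bm{x}$, $\bm{y}\ne\bm{x}$; with $\mathfrak{P}_k$ the set of these, $\mathrm{cl}(\mathfrak{P}_k)$ is the smallest set containing $\mathfrak{P}_k$ closed under componentwise maximum $\vee$. A formation of $\bm{x}\in\mathrm{cl}(\mathfrak{P}_k)$ is a nonempty subset $\{\bm{x}_{i_1},\ldots,\bm{x}_{i_j}\}\subseteq\mathfrak{P}_k$ with $\bm{x}=\bm{x}_{i_1}\vee\cdots\vee\bm{x}_{i_j}$, odd/even according to parity of $j$. $\delta_k(\bm{x})=$ (number of odd formations) $-$ (number of even formations) on $\mathrm{cl}(\mathfrak{P}_k)$, $0$ elsewhere;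 the signed domination is $d(\phi_k)=\delta_k(m,\ldots,m)$. *)

(* Defs.v *)
From HB Require Import structures.
From mathcomp Require Import all_boot all_order all_algebra.

Set Implicit Arguments.
Unset Strict Implicit.
Unset Printing Implicit Defensive.

Import Order.TTheory GRing.Theory Num.Theory.

Local Open Scope ring_scope.

Notation svec n m := {ffun 'I_n -> 'I_m.+1}.

Definition vle (n m : nat) (x y : svec n m) : bool :=
  [forall i, (x i <= y i)%N].

Definition vmax (n m : nat) (x y : svec n m) : svec n m :=
  [ffun i => Order.max (x i) (y i)].

Definition vzero (n m : nat) : svec n m := [ffun _ => ord0].

Definition vtop (n m : nat) : svec n m := [ffun _ => ord_max].

Lemma vmaxA (n m : nat) : associative (@vmax n m).
Proof. by move=> x y z; apply/ffunP => i; rewrite !ffunE maxA. Qed.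

Lemma vmaxC (n m : nat) : commutative (@vmax n m).
Proof. by move=> x y; apply/ffunP => i; rewrite !ffunE maxC. Qed.

Lemma vmax0x (n m : nat) : left_id (vzero n m) (@vmax n m).
Proof. by move=> x; apply/ffunP => i; rewrite !ffunE; exact: max_r. Qed.

HB.instance Definition _ (n m : nat) :=
  Monoid.isComLaw.Build (svec n m) (vzero n m) (@vmax n m)
    (@vmaxA n m) (@vmaxC n m) (@vmax0x n m).

(* A multistate monotone system with [n] components, each with state set
   {0, ..., m}, and system state set {0, ..., M}. *)
Record mms (n m M : nat) := MMS {
  structure_function :> svec n m -> 'I_M.+1;
  structure_function_mono : forall x y : svec n m,
    vle x y -> (structure_function x <= structure_function y)%N
}.

Definition level_function (n m M : nat) (phi : mms n m M) (k : nat) :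
    pred (svec n m) :=
  fun x => (k <= phi x)%N.

Section SignedDomination.
Variables (n m : nat) (phi : pred (svec n m)).

Definition min_path_vectors : {set svec n m} :=
  [set x | phi x && [forall y, (vle y x && (y != x)) ==> ~~ phi y]].

Definition vmax_closed (A : {set svec n m}) : bool :=
  [forall x in A, forall y in A, vmax x y \in A].

Definition cl (A : {set svec n m}) : {set svec n m} :=
  \bigcap_(B : {set svec n m} | (A \subset B) && vmax_closed B) B.

(* As [F] is required to be nonempty and [vzero] is the least vector, the
   iterated operator is the maximum of the elements of [F]. *)
Definition formations (x : svec n m) : {set {set svec n m}} :=
  [set F : {set svec n m} |
    [&& F != set0, F \subset min_path_vectors
      & \big[@vmax n m/vzero n m]_(y in F) y == x]].

Definition delta (x : svec n m) : int :=
  if x \in cl min_path_vectors then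
    #|[set F in formations x | odd #|F|]|%:Z
    - #|[set F in formations x | ~~ odd #|F|]|%:Z
  else 0.

Definition signed_domination : int := delta (vtop n m).

End SignedDomination.

Lemma sum_state_lt (n m : nat) (x : svec n m) :
  (\sum_(i < n) x i < (n * m).+1)%N.
Proof.
rewrite ltnS -[X in (X * m)%N](card_ord n) -sum_nat_const.
by apply: leq_sum => i _; rewrite -ltnS.
Qed.

Lemma sum_state_mono (n m : nat) (x y : svec n m) :
  vle x y ->
  (Ordinal (sum_state_lt x) <= Ordinal (sum_state_lt y))%N.
Proof. by move=> /forallP le_xy; apply: leq_sum => i _; exact: le_xy. Qed.

Definition sum_system (n m : nat) : mms n m (n * m) :=
  @MMS n m (n * m) (fun x => Ordinal (sum_state_lt x)) (@sum_state_mono n m).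

Lemma level_sum_systemE (n m k : nat) (x : svec n m) :
  level_function (sum_system n m) k x = (k <= \sum_(i < n) x i)%N.
Proof. by []. Qed.

(* Main.v *)
Require Import Defs.
From mathcomp Require Import all_boot all_order all_algebra.
From mathcomp Require Import zify.

Import Order.TTheory GRing.Theory Num.Theory.

Local Open Scope ring_scope.

(** The minimal [k]-level path vectors are the vectors with coordinate sum [k].
    A set [F] of them has join [(m, ..., m)] iff no coordinate stays below [m]
    on all of [F]; inclusion-exclusion over the set [A] of coordinates that stay
    below [m], followed by summation of the signs of all [F] compatible with
    [A], leaves only those [A] that admit no compatible path vector, i.e. those
    with [#|A| > n m - k]. The remaining sum is, up to sign, the truncated
    alternating sum of the binomials [C(n, j)] for [j <= n m - k], which equals
    [(-1)^(n m - k) C(n - 1, n m - k)]. *)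

(** Distributing the product of the factors [1 - (i \in B)] gives the sum; any element of [B] makes
    one factor vanish. *)
Lemma sum_sign_subsets (R : comPzRingType) (I : finType) (B : {set I}) :
  \sum_(A : {set I} | A \subset B) (-1) ^+ #|A| = (B == set0)%:R :> R.
Proof.
transitivity (\prod_i (- (i \in B)%:R + 1) : R).
  rewrite bigA_distr big_mkcond /=; apply: eq_bigr => A _.
  case: ifP => [/subsetP sAB | /negbT/subsetPn[i iA iB]]; last first.
    by rewrite (bigD1 i) //= iA (negPf iB) oppr0 mul0r.
  rewrite -big_mkcond /= -prodr_const.
  by apply: eq_bigr => i iA; rewrite sAB.
case: eqP => [-> | /eqP/set0Pn[i iB]].
  by rewrite big1 // => i _; rewrite inE oppr0 add0r.
by rewrite (bigD1 i) //= iB addNr mul0r.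
Qed.

(** Induction on [r]: Pascal's rule splits the count of the new layer, and one of its two terms
    cancels the previous sum. *)
Lemma sum_sign_small_subsets (R : pzRingType) (I : finType) (r : nat) :
  (0 < #|I|)%N ->
  \sum_(A : {set I} | (#|A| <= r)%N) (-1) ^+ #|A|
    = (-1) ^+ r *+ 'C(#|I|.-1, r) :> R.
Proof.
move=> /prednK I_gt0; elim: r => [|r IHr].
  rewrite (big_pred1 set0) => [|A]; last by rewrite leqn0 cards_eq0.
  by rewrite cards0 bin0.
rewrite (bigID (fun A : {set I} => #|A| <= r)%N) /=.
rewrite (eq_bigl (fun A : {set I} => #|A| <= r)%N) => [|A]; last by lia.
rewrite IHr (eq_bigl [in [set A : {set I} | #|A| == r.+1]]) => [|A]; last first.
  by rewrite inE; lia.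
rewrite (eq_bigr (fun=> (-1) ^+ r.+1)) => [|A]; last by rewrite inE => /eqP ->.
rewrite sumr_const card_draws -I_gt0 binS mulrnDr exprS mulN1r !mulNrn /=.
by rewrite addrCA subrr addr0.
Qed.

Lemma vle_sum_eq (n m : nat) (x y : svec n m) :
  vle y x -> (\sum_i x i <= \sum_i y i)%N -> y = x.
Proof.
move=> /forallP le_yx.
have [le_sum eq_sum] := leqif_sum (P := predT) (fun i _ => leqif_eq (le_yx i)).
move=> ge_sum; move: eq_sum; rewrite eqn_leq le_sum ge_sum.
by move=> /esym/forallP eq_yx; apply/ffunP => i; apply/val_inj/eqP/eq_yx.
Qed.

(** A positive coordinate is lowered by one until the excess [d] over [j] is used up. *)
Lemma exists_vle_sum (n m j : nat) (x : svec n m) :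
  (j <= \sum_i x i)%N -> exists2 y, vle y x & (\sum_i y i)%N = j.
Proof.
move: {2}(_ - j)%N (erefl (\sum_i x i - j)%N) => d.
elim: d x => [|d IHd] x def_d le_jx.
  by exists x; [apply/forallP => i | lia].
have [i xi_gt0]: exists i, (0 < x i)%N.
  apply/existsP; apply: contraT => /existsPn x0.
  suff: (\sum_i x i = 0)%N by lia.
  by apply: big1 => i _; move: (x0 i); lia.
pose x' : svec n m := [ffun l => if l == i then inord (x i).-1 else x l].
have x'i : x' i = (x i).-1 :> nat.
  by rewrite ffunE eqxx inordK //; have := ltn_ord (x i); lia.
have x'l l : l != i -> x' l = x l by rewrite ffunE => /negPf ->.
have sum_x' : (\sum_l x l = (\sum_l x' l).+1)%N.
  rewrite (bigD1 i) //= [in RHS](bigD1 i) //= x'i.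
  by rewrite [in RHS](eq_bigr (fun l => x l : nat)) => [|l /x'l ->] //;
    rewrite -addSn prednK.
have [||y /forallP le_yx' sum_y] := IHd x'; try by lia.
exists y => //; apply/forallP => l; apply: leq_trans (le_yx' l) _.
by have [->|/x'l ->//] := eqVneq l i; rewrite x'i leq_pred.
Qed.

Lemma min_path_vectors_sum (n m k : nat) :
  min_path_vectors (level_function (sum_system n m) k)
    = [set x : svec n m | (\sum_i x i)%N == k].
Proof.
apply/setP => x; rewrite !inE level_sum_systemE.
apply/andP/eqP => [[le_kx /forallP min_x] | <-]; last first.
  split=> //; apply/forallP => y; apply/implyP => /andP[le_yx].
  by rewrite level_sum_systemE; apply: contra => /(vle_sum_eq _ _ _ _ le_yx) ->.
have [y le_yx sum_y] := exists_vle_sum _ _ _ _ le_kx.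
have:= min_x y; rewrite le_yx level_sum_systemE sum_y leqnn /= implybF negbK.
by move=> /eqP <-.
Qed.

(** The join is a maximum in each coordinate, so it stays below [m] exactly where all members of [F]
    do. *)
Lemma bigvmax_eq_top (n m : nat) (F : {set svec n m}) : (0 < m)%N ->
  (\big[@vmax n m/vzero n m]_(y in F) y == vtop n m)
    = ([set i | [forall y in F, (y i < m)%N]] == set0).
Proof.
move=> m_gt0; set z := \big[_/_]_(y in F) y.
have zE i : z i = (\max_(y in F) y i)%N :> nat.
  rewrite /z (big_morph (fun x : svec n m => x i : nat)
    (id1 := 0%N) (op1 := maxn)) //.
    by move=> x y; rewrite ffunE /Order.max ltEord /maxn; case: ifP.
  by rewrite ffunE.
have z_lt i : (z i < m)%N = [forall y in F, (y i < m)%N].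
  have ltE j : (j < m)%N = (j <= m.-1)%N by lia.
  by rewrite zE ltE; apply/bigmax_leqP/forall_inP => le_y y /le_y; rewrite ltE.
apply/eqP/eqP => [z_top | /setP z_top].
  by apply/setP => i; rewrite !inE -z_lt z_top ffunE ltnn.
apply/ffunP => i; apply/val_inj; rewrite ffunE /=.
have := z_top i; rewrite !inE -z_lt => /negbT; rewrite -leqNgt => le_mz.
by apply/eqP; rewrite eqn_leq le_mz -ltnS ltn_ord.
Qed.

Lemma bigvmax_in_cl (n m : nat) (P F : {set svec n m}) :
  F != set0 -> F \subset P ->
  \big[@vmax n m/vzero n m]_(y in F) y \in cl P.
Proof.
move=> F_neq0 sFP; apply/bigcapP => B /andP[sPB /forall_inP clB].
have {clB}clB x y : x \in B -> y \in B -> vmax x y \in B.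
  by move=> xB yB; apply: (forall_inP (clB x xB)).
have [y0 y0F] := set0Pn _ F_neq0.
have FB y : y \in F -> y \in B by move=> yF; apply/(subsetP sPB)/(subsetP sFP).
(* [vzero] need not lie in [B], so [y0] is kept joined to every partial join. *)
rewrite (bigD1 y0) //=; apply: (big_rec (fun z => vmax y0 z \in B)).
  suff -> : vmax y0 (vzero n m) = y0 by exact: FB.
  by rewrite vmaxC vmax0x.
move=> y z /andP[yF _] zB.
by rewrite vmaxA (vmaxC y0) -vmaxA; apply: clB => //; exact: FB.
Qed.

(** Outside the closure there are no formations, so the default value 0 agrees with the empty
    sum. *)
Lemma delta_sum_formations (n m : nat) (phi : pred (svec n m)) (x : svec n m) :
  delta phi x = - \sum_(F in formations phi x) (-1) ^+ #|F|.
Proof.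
rewrite (bigID (fun F : {set svec n m} => odd #|F|)) /=.
rewrite (eq_bigr (fun=> -1)) => [|F /andP[_ oddF]]; last first.
  by rewrite -signr_odd oddF.
rewrite [X in _ + X](eq_bigr (fun=> 1)) => [|F /andP[_ evenF]]; last first.
  by rewrite -signr_odd (negPf evenF).
rewrite /delta; case: ifPn => [_ | x_cl].
  rewrite !sumr_const mulNrn opprD opprK !natz.
  by congr (Posz _ - Posz _); apply: eq_card => F;
    rewrite [LHS]inE [RHS]unfold_in.
rewrite !big_pred0 ?addr0 ?oppr0 // => F; rewrite inE.
all: apply: contraNF x_cl => /andP[/and3P[F_neq0 sFP /eqP <-] _].
all: exact: bigvmax_in_cl.
Qed.

(** The largest vector capped on [A] is [m - 1] on [A] and [m] elsewhere, with sum [n m - #|A|];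
    lowering it reaches every smaller sum. *)
Lemma capped_sum_vectors_eq0 (n m k : nat) (A : {set 'I_n}) : (0 < m)%N ->
  ([set x : svec n m | ((\sum_i x i)%N == k) && [forall i in A, (x i < m)%N]]
     == set0) = ~~ (k + #|A| <= n * m)%N.
Proof.
move=> m_gt0; apply/idP/idP.
  apply: contraTN => le_kA; apply/set0Pn.
  pose x : svec n m := [ffun i => if i \in A then inord m.-1 else ord_max].
  have xE i : (x i + (i \in A) = m)%N.
    by rewrite ffunE; case: ifP => _ /=; rewrite ?inordK; lia.
  have sum_x : (\sum_i x i + #|A| = n * m)%N.
    rewrite -sum1_card [X in (_ + X)%N]big_mkcond -big_split /=.
    rewrite (eq_bigr (fun=> m)) => [|i _]; last first.
      by rewrite -[RHS](xE i); case: ifP.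
    by rewrite sum_nat_const card_ord.
  have [|y /forallP le_yx sum_y] := exists_vle_sum n m k x; first by lia.
  exists y; rewrite inE sum_y eqxx; apply/forall_inP => i iA.
  by have := xE i; have := le_yx i; rewrite iA /=; lia.
apply: contraNT => /set0Pn[x]; rewrite inE => /andP[/eqP <- /forall_inP ltx].
rewrite -sum1_card [X in (_ + X)%N]big_mkcond -big_split /=.
rewrite -[X in (X * m)%N](card_ord n) -sum_nat_const; apply: leq_sum => i _.
by case: ifP => [/ltx|_]; rewrite ?addn1 // addn0 -ltnS ltn_ord.
Qed.

Theorem theorem5p3 (n m k : nat) (hn : (1 <= n)%N) (hm : (1 <= m)%N)
    (hk : (1 <= k <= n * m)%N) :
  signed_domination (level_function (sum_system n m) k) =
    if (n * (m - 1) < k <= n * m)%N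
    then (-1) ^+ (n - (k - n * (m - 1)))
         * 'C(n - 1, (k - n * (m - 1)) - 1)%:Z
    else 0.
Proof.
pose P := [set x : svec n m | (\sum_i x i)%N == k].
pose B (F : {set svec n m}) := [set i | [forall y in F, (y i < m)%N]].
pose PA (A : {set 'I_n}) :=
  [set x : svec n m | ((\sum_i x i)%N == k) && [forall i in A, (x i < m)%N]].
(* For fixed [A], the compatible [F] are thus all subsets of one set, and their signs can be
   summed. *)
have sub_PA (F : {set svec n m}) (A : {set 'I_n}) :
    (F \subset P) && (A \subset B F) = (F \subset PA A).
  apply/andP/subsetP => [[/subsetP sFP /subsetP sAB] y yF | sF].
    have := sFP y yF; rewrite !inE => -> /=; apply/forall_inP => i /sAB.
    by rewrite inE => /forall_inP; apply.
  split; apply/subsetP; first by move=> y /sF; rewrite !inE => /andP[].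
  move=> i iA; rewrite inE; apply/forall_inP => y /sF.
  by rewrite inE => /andP[_ /forall_inP]; apply.
have -> : signed_domination (level_function (sum_system n m) k)
    = \sum_(A : {set 'I_n} | (#|A| <= n * m - k)%N) (-1) ^+ #|A|.
  rewrite /signed_domination delta_sum_formations.
  rewrite (eq_bigl (fun F : {set svec n m} =>
      (F \subset P) && (B F == set0))) => [|F]; last first.
    rewrite inE min_path_vectors_sum bigvmax_eq_top //.
    (* The empty [F] is excluded on the right as well: [B set0] is all of ['I_n], which is
       nonempty. *)
    case: eqVneq => //= ->; rewrite sub0set /=; apply/esym/negbTE/set0Pn.
    by exists (Ordinal hn); rewrite inE; apply/forall_inP => y; rewrite inE.
  rewrite big_mkcondr /=.
  (* The indicator of [B F == set0] is expanded as an alternating sum over the subsets of [B F]. *)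
  rewrite (eq_bigr (fun F : {set svec n m} =>
      \sum_(A : {set 'I_n} | A \subset B F) (-1) ^+ #|A| * (-1) ^+ #|F|));
    last first.
    by move=> F _; rewrite -mulr_suml sum_sign_subsets; case: eqP => _;
      rewrite ?mul1r ?mul0r.
  rewrite (exchange_big_dep xpredT) //=.
  rewrite (eq_bigr (fun A : {set 'I_n} =>
      if ~~ (#|A| <= n * m - k)%N then (-1) ^+ #|A| else 0)); last first.
    move=> A _; rewrite -mulr_sumr (eq_bigl (fun F : {set svec n m} =>
      F \subset PA A)) //.
    rewrite sum_sign_subsets capped_sum_vectors_eq0 //.
    have -> : (k + #|A| <= n * m)%N = (#|A| <= n * m - k)%N by lia.
    by case: (_ <= _)%N; rewrite ?mulr1 ?mulr0.
  (* The signs of all [A] sum to 0 since [n >= 1], so the sum over large [A] is the opposite of that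
     over small [A]. *)
  rewrite -big_mkcond /=; apply/esym/eqP; rewrite -addr_eq0.
  have := sum_sign_subsets int 'I_n setT.
  rewrite (bigID (fun A : {set 'I_n} => #|A| <= n * m - k)%N) /=.
  under eq_bigl do rewrite subsetT /=.
  under [X in _ + X]eq_bigl do rewrite subsetT /=.
  by move=> ->; rewrite -cards_eq0 cardsT card_ord; case: (n) hn.
rewrite sum_sign_small_subsets ?card_ord // -mulr_natr natz.
have nmE : (n * m = n * (m - 1) + n)%N by rewrite -mulnSr subn1 prednK.
(* If [k <= n (m - 1)], then [n m - k >= n] exceeds [n - 1] and the binomial is 0. *)
case: ifP => lt_k; last by rewrite bin_small ?mulr0 //; lia.
(* Symmetry of the binomial turns [n m - k] into [n - 1 - (n m - k)], which is
   [k - n (m - 1) - 1]. *)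
rewrite -bin_sub; last by lia.
by congr ((-1) ^+ _ * 'C(_, _)%:Z); lia.
Qed.
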